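(* Let $X$ be a Banach space in which every relatively weakly compact set is relatively super weakly compact (for example, a Banach space with property (R)). Then $X$ has the weak Banach-Saks property.
   Context: Relatively super weakly compact sets: For a Banach space $Y$ and a free ultrafilter $\mathcal{U}$ on $\mathbb{N}$, $Y^{\mathcal{U}}$ is the quotient of $\ell_\infty(Y)$ by $\{(y_n)_n\in\ell_\infty(Y):\lim_{\mathcal{U}}\|y_n\|=0\}$. For $A\subseteq Y$, $A^{\mathcal{U}}\subseteq Y^{\mathcal{U}}$ is the set of elements having a representative $(y_n)_n$ with $y_n\in A$ for every $n$. The set $A$ is relatively super weakly compact if $A^{\mathcal{U}}$ is relatively weakly compact in $Y^{\mathcal{U}}$ for every free ultrafilter $\mathcal{U}$ on $\mathbb{N}$. Weakly precompact sets and property (R): A bounded subset $A$ of a Banach space is weakly precompact if it does not contain a sequence equivalent to the canonical basis of $\ell_1$. A Banach space has property (R) if every weakly precompact set in it is relatively super weakly compact. Weak Banach-Saks property: A sequence $(x_n)_{n\in\mathbb{N}}$ is Cesaro summable if the sequence of arithmetic means $(n^{-1}\sum_{k=1}^n x_k)_{n\in\mathbb{N}}$ is norm convergent. A bounded subset $A$ of a Banach space is a weak Banach-Saks set if every weakly convergent sequence in $A$ has a Cesaro summable subsequence. A Banach space $X$ has the weak Banach-Saks property if its closed unit ball $B_X$ is a weak Banach-Saks set. *)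

(* Defs.v *)
From HB Require Import structures.
From mathcomp Require Import all_boot all_order all_algebra.
From mathcomp Require Import generic_quotient ring_quotient.
From mathcomp Require Import all_classical all_reals all_analysis.

Set Implicit Arguments.
Unset Strict Implicit.
Unset Printing Implicit Defensive.

Import Order.TTheory GRing.Theory Num.Theory.
Import numFieldNormedType.Exports.

Local Open Scope classical_set_scope.
Local Open Scope ring_scope.
Local Open Scope quotient_scope.

Section WeakTopology.
Variables (R : realType) (V : normedModType R).

Definition dual : Type := {f : {linear V -> R^o} | continuous f}.

Definition weak : topologicalType :=
  sup_topology (fun f : dual =>
    Topological.on (initial_topology (sval f : V -> R^o))).

Definition weakly_cvg (x : nat -> V) (l : V) : Prop :=
  (x : nat -> weak) @ \oo --> (l : weak).

Definition relatively_weakly_compact (A : set V) : Prop :=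
  compact (closure (A : set weak)).

End WeakTopology.

Section Linfty.
Variables (R : realType) (Y : normedModType R).

Definition bounded_seqs : {pred (nat -> Y)} := fun x => `[< bounded_fun x >].

Lemma bounded_seqsP (x : nat -> Y) :
  reflect (exists M : R, forall n, `|x n| <= M) (x \in bounded_seqs).
Proof.
have PF : ProperFilter (globally [set: nat]).
  exact: (@globally_properfilter _ _ 0%N).
apply: (iffP (asboolP _)) => [/(@ex_bound _ _ _ _ _ PF)[M xM]|[M xM]].
  by exists M => n; exact: xM.
by apply/(@ex_bound _ _ _ _ _ PF); exists M => n _; exact: xM.
Qed.

Lemma bounded_seqs_submod : submod_closed bounded_seqs.
Proof.
split=> [|a x y /bounded_seqsP[M xM] /bounded_seqsP[N yN]].
  by apply/bounded_seqsP; exists 0 => n; rewrite normr0.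
apply/bounded_seqsP; exists (`|a| * M + N) => n.
by rewrite (le_trans (ler_normD _ _))// lerD// normrZ ler_wpM2l.
Qed.

HB.instance Definition _ :=
  GRing.isSubmodClosed.Build R (nat -> Y) bounded_seqs bounded_seqs_submod.

Record linfty := Linfty {
  linfty_val :> nat -> Y ;
  linfty_valP : linfty_val \in bounded_seqs }.

HB.instance Definition _ := [isSub for linfty_val].
HB.instance Definition _ := [Choice of linfty by <:].
HB.instance Definition _ := [SubChoice_isSubLmodule of linfty by <:].

Definition linfty_norm (x : linfty) : R := sup (range (fun n => `|x n|)).

Lemma linfty_has_sup (x : linfty) : has_sup (range (fun n => `|x n|)).
Proof.
split; first by exists `|x 0%N|, 0%N.
have /bounded_seqsP[M xM] := linfty_valP x.
by exists M => _ [n _ <-].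
Qed.

Lemma linfty_norm_ub (x : linfty) n : `|x n| <= linfty_norm x.
Proof. by apply: ub_le_sup; [have [] := linfty_has_sup x|exists n]. Qed.

Lemma linfty_norm_le (x : linfty) M :
  (forall n, `|x n| <= M) -> linfty_norm x <= M.
Proof.
by move=> xM; apply: ge_sup => [|_ [n _ <-]//]; exists `|x 0%N|, 0%N.
Qed.

Lemma linfty_normD (x y : linfty) :
  linfty_norm (x + y) <= linfty_norm x + linfty_norm y.
Proof.
apply: linfty_norm_le => n.
by rewrite (le_trans (ler_normD _ _))// lerD// linfty_norm_ub.
Qed.

Lemma linfty_norm_ge0 (x : linfty) : 0 <= linfty_norm x.
Proof. exact: le_trans (linfty_norm_ub x 0). Qed.

Lemma linfty_normZ a (x : linfty) : linfty_norm (a *: x) = `|a| * linfty_norm x.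
Proof.
have le b (y : linfty) : linfty_norm (b *: y) <= `|b| * linfty_norm y.
  apply: linfty_norm_le => n.
  by rewrite normrZ ler_wpM2l// linfty_norm_ub.
apply/eqP; rewrite eq_le le /=.
have [->|a0] := eqVneq a 0; first by rewrite normr0 mul0r linfty_norm_ge0.
have := le a^-1 (a *: x).
by rewrite scalerA mulVf// scale1r normfV ler_pdivlMl ?normr_gt0.
Qed.

Lemma linfty_norm0_eq0 (x : linfty) : linfty_norm x = 0 -> x = 0.
Proof.
move=> x0; apply/val_inj/funext => n.
by apply/normr0_eq0/eqP; rewrite eq_le normr_ge0 andbT -x0 linfty_norm_ub.
Qed.

HB.instance Definition _ := Lmodule_isNormed.Build R linfty
  linfty_normD linfty_normZ linfty_norm0_eq0.

End Linfty.

Record free_ultrafilter := FreeUltrafilter {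
  fu_set : set_system nat ;
  fu_ultra : UltraFilter fu_set ;
  fu_free : \bigcap_(A in fu_set) A = set0 }.

#[global] Existing Instance fu_ultra.

Section Ultrapower.
Variables (R : realType) (Y : normedModType R) (U : free_ultrafilter).

Definition null_seqs : {pred linfty Y} :=
  fun x => `[< `|x n| @[n --> fu_set U] --> (0 : R) >].

Lemma null_seqsP (x : linfty Y) :
  reflect (forall e : R, 0 < e -> fu_set U [set n | `|x n| < e]) (x \in null_seqs).
Proof.
apply: (iffP (asboolP _)) => [/cvgr0Pnorm_lt xU e e0|xU].
  by have := xU _ e0; apply: filterS => n /=; rewrite normr_id.
apply/cvgr0Pnorm_lt => e e0.
by have := xU _ e0; apply: filterS => n /=; rewrite normr_id.
Qed.

Lemma null_seqs_submod : submod_closed null_seqs.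
Proof.
split=> [|a x y /null_seqsP xU /null_seqsP yU].
  apply/null_seqsP => e e0; apply: (filterS _ filterT) => n _ /=.
  by rewrite normr0.
apply/null_seqsP => e e0.
have d0 : 0 < e / 2 / (`|a| + 1) by rewrite !divr_gt0// ltr_wpDl.
have e20 : 0 < e / 2 by rewrite divr_gt0.
apply: filterS (filterI (xU _ d0) (yU _ e20)) => n [/= xn yn].
rewrite (le_lt_trans (ler_normD _ _))// [e]splitr ler_ltD//.
rewrite normrZ (@le_trans _ _ ((`|a| + 1) * `|x n|))//.
  by rewrite ler_wpM2r// lerDl.
by rewrite -ler_pdivlMl ?ltr_wpDl// mulrC ltW.
Qed.

HB.instance Definition _ :=
  GRing.isSubmodClosed.Build R (linfty Y) null_seqs null_seqs_submod.

Definition ultrapower : Type := Quotient.quot null_seqs.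

HB.instance Definition _ := GRing.Zmodule.on ultrapower.
HB.instance Definition _ := Quotient.on ultrapower.

Definition ultra_class (x : linfty Y) : ultrapower := \pi_ultrapower x.

Lemma ultra_class_eq (x y : linfty Y) :
  (ultra_class x = ultra_class y) <-> (x - y \in null_seqs).
Proof.
rewrite (Quotient.idealrBE null_seqs); split=> [?|/eqP//]; exact/eqP.
Qed.

Lemma ultra_class_surj (q : ultrapower) : exists x, ultra_class x = q.
Proof. by exists (repr q); rewrite /ultra_class reprK. Qed.

Lemma ultra_classD (x y : linfty Y) :
  ultra_class (x + y) = ultra_class x + ultra_class y.
Proof. exact: (raddfD (\pi_(Quotient.quot null_seqs) : {additive _ -> _})). Qed.

Definition ultra_scale (a : R) (q : ultrapower) : ultrapower :=
  ultra_class (a *: repr q).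

Lemma ultra_scaleE a (x : linfty Y) :
  ultra_scale a (ultra_class x) = ultra_class (a *: x).
Proof.
apply/ultra_class_eq; rewrite -scalerBr rpredZ//.
by apply/ultra_class_eq; rewrite /ultra_class reprK.
Qed.

Lemma ultra_scaleA a b (q : ultrapower) :
  ultra_scale a (ultra_scale b q) = ultra_scale (a * b) q.
Proof. by have [x <-] := ultra_class_surj q; rewrite !ultra_scaleE scalerA. Qed.

Lemma ultra_scale1 : left_id 1 ultra_scale.
Proof.
by move=> q; have [x <-] := ultra_class_surj q; rewrite ultra_scaleE scale1r.
Qed.

Lemma ultra_scaleDr : right_distributive ultra_scale +%R.
Proof.
move=> a p q; have [x <-] := ultra_class_surj p.
have [y <-] := ultra_class_surj q.
by rewrite -ultra_classD !ultra_scaleE scalerDr ultra_classD.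
Qed.

Lemma ultra_scaleDl (q : ultrapower) : {morph ultra_scale^~ q : a b / a + b}.
Proof.
move=> a b; have [x <-] := ultra_class_surj q.
by rewrite !ultra_scaleE scalerDl ultra_classD.
Qed.

HB.instance Definition _ := GRing.Zmodule_isLmodule.Build R ultrapower
  ultra_scaleA ultra_scale1 ultra_scaleDr ultra_scaleDl.

Lemma ultra_classZ a (x : linfty Y) :
  ultra_class (a *: x) = a *: ultra_class x.
Proof. by rewrite -ultra_scaleE. Qed.

Lemma ultra_class0 : ultra_class 0 = 0.
Proof. by rewrite -(scale0r (0 : linfty Y)) ultra_classZ scale0r. Qed.

(* norm of the quotient of linfty by null_seqs *)
Definition ultra_norm (q : ultrapower) : R :=
  inf [set `|x| | x in [set x : linfty Y | ultra_class x = q]].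

Lemma ultra_norm_has_inf (q : ultrapower) :
  has_inf [set `|x| | x in [set x : linfty Y | ultra_class x = q]].
Proof.
have [x xq] := ultra_class_surj q.
by split; [exists `|x|, x|exists 0 => _ [y _ <-]].
Qed.

Lemma ultra_norm_le (x : linfty Y) : ultra_norm (ultra_class x) <= `|x|.
Proof.
by apply: ge_inf; [have [] := ultra_norm_has_inf (ultra_class x)|exists x].
Qed.

Lemma ultra_norm_adherent (q : ultrapower) (e : R) : 0 < e ->
  exists x : linfty Y, ultra_class x = q /\ `|x| < ultra_norm q + e.
Proof.
move=> e0; have [_ [x xq <-] xe] := inf_adherent e0 (ultra_norm_has_inf q).
by exists x.
Qed.

Lemma ultra_norm_ge0 (q : ultrapower) : 0 <= ultra_norm q.
Proof.
by apply: lb_le_inf; [have [] := ultra_norm_has_inf q|move=> _ [y _ <-]].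
Qed.

Lemma ultra_normD (p q : ultrapower) :
  ultra_norm (p + q) <= ultra_norm p + ultra_norm q.
Proof.
apply/ler_addgt0Pr => e e0.
have e20 : 0 < e / 2 by rewrite divr_gt0.
have [x [xp xe]] := ultra_norm_adherent p e20.
have [y [yq ye]] := ultra_norm_adherent q e20.
rewrite -{1}xp -{1}yq -ultra_classD (le_trans (ultra_norm_le _))//.
rewrite (le_trans (ler_normD _ _))// [e]splitr addrACA.
by rewrite lerD// ltW.
Qed.

Lemma ultra_normZ a (q : ultrapower) : ultra_norm (a *: q) = `|a| * ultra_norm q.
Proof.
have le b (p : ultrapower) : ultra_norm (b *: p) <= `|b| * ultra_norm p.
  apply/ler_addgt0Pr => e e0.
  have d0 : 0 < e / (`|b| + 1) by rewrite divr_gt0// ltr_wpDl.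
  have [x [xp xe]] := ultra_norm_adherent p d0.
  rewrite -{1}xp -ultra_classZ (le_trans (ultra_norm_le _))// normrZ.
  rewrite (@le_trans _ _ (`|b| * (ultra_norm p + e / (`|b| + 1))))//.
    by rewrite ler_wpM2l// ltW.
  rewrite mulrDr lerD2l mulrCA ler_piMr ?(ltW e0)//.
  by rewrite ler_pdivrMr ?ltr_wpDl// mul1r lerDl.
apply/eqP; rewrite eq_le le /=.
have [->|a0] := eqVneq a 0; first by rewrite normr0 mul0r ultra_norm_ge0.
have := le a^-1 (a *: q).
by rewrite scalerA mulVf// scale1r normfV ler_pdivlMl ?normr_gt0.
Qed.

Lemma ultra_norm0_eq0 (q : ultrapower) : ultra_norm q = 0 -> q = 0.
Proof.
have [x <-] := ultra_class_surj q => x0.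
rewrite -ultra_class0; apply/ultra_class_eq; rewrite subr0.
apply/null_seqsP => e e0.
have e20 : 0 < e / 2 by rewrite divr_gt0.
have [y [/esym/ultra_class_eq/null_seqsP xy]] :=
  ultra_norm_adherent (ultra_class x) e20.
rewrite x0 add0r => ye.
apply: filterS (xy _ e20) => n /= xyn.
rewrite -[x n](subrK (y n)) (le_lt_trans (ler_normD _ _))// [e]splitr.
by rewrite ltrD// (le_lt_trans _ ye)// linfty_norm_ub.
Qed.

HB.instance Definition _ := Lmodule_isNormed.Build R ultrapower
  ultra_normD ultra_normZ ultra_norm0_eq0.

Definition ultra_set (A : set Y) : set ultrapower :=
  [set q | exists2 x : linfty Y, (forall n, A (x n)) & ultra_class x = q].

End Ultrapower.

Arguments ultra_class {R Y} U x.
Arguments ultra_set {R Y} U A.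

Section Properties.
Variables (R : realType) (X : normedModType R).

Definition relatively_super_weakly_compact (A : set X) : Prop :=
  forall U : free_ultrafilter, relatively_weakly_compact (ultra_set U A).

(* the norm of a finite combination of the canonical basis of l_1 with
   coefficients a_k is the sum of the |a_k| *)
Definition equivalent_to_l1_basis (x : nat -> X) : Prop :=
  exists c C : R, [/\ 0 < c, 0 < C & forall (n : nat) (a : nat -> R),
    c * \sum_(k < n) `|a k| <= `|\sum_(k < n) a k *: x k|
                            <= C * \sum_(k < n) `|a k| ].

Definition weakly_precompact (A : set X) : Prop :=
  bounded_set A /\
  ~ (exists x : nat -> X, (forall n, A (x n)) /\ equivalent_to_l1_basis x).

Definition property_R : Prop :=
  forall A : set X, weakly_precompact A -> relatively_super_weakly_compact A.

(* indices start at 0: the n-th term is the mean of x 0, ..., x n *)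
Definition cesaro_summable (x : nat -> X) : Prop :=
  cvgn (fun n : nat => n.+1%:R^-1 *: \sum_(k < n.+1) x k).

Definition weak_banach_saks_set (A : set X) : Prop :=
  bounded_set A /\
  forall x : nat -> X, (forall n, A (x n)) -> (exists l, weakly_cvg x l) ->
    exists2 phi : nat -> nat,
      {homo phi : m n / (m < n)%N} & cesaro_summable (x \o phi).

Definition weak_banach_saks_property : Prop :=
  weak_banach_saks_set [set x : X | `|x| <= 1].

End Properties.

Arguments property_R {R} X.
Arguments weak_banach_saks_property {R} X.

(* Main.v *)
Require Import Defs.
From HB Require Import structures.
From mathcomp Require Import all_boot all_order all_algebra.
From mathcomp Require Import all_classical all_reals all_analysis.
From mathcomp Require Import ring lra zify.

Set Implicit Arguments.
Unset Strict Implicit.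
Unset Printing Implicit Defensive.

Import Order.TTheory GRing.Theory Num.Theory.
Import numFieldNormedType.Exports.

Local Open Scope classical_set_scope.
Local Open Scope ring_scope.

(** Both halves rest on one fact: a relatively weakly compact set A contains no
    sequence with a lower l_1-estimate
    c * sum |a k| <= |sum a k *: x k| (l1_not_relatively_weakly_compact). A weak
    cluster point of such a sequence would, by Mazur's theorem, be a norm limit
    of affine combinations of the terms of any tail, but affine combinations
    with disjoint supports stay at distance at least c from each other. As
    relatively weakly compact sets are also bounded, they are weakly
    precompact, so property (R) applies to them.

    For the weak Banach-Saks property, let x n tend weakly to l in the unit
    ball, put y n = x n - l, and fix an ultrafilter U containing the tails. The
    iterated limits of |a1 *: y n1 + .. + am *: y nm| along U define the norm
    of the spreading model of y, without any appeal to Ramsey's theorem. This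
    norm is convex and, y being weakly null, it does not increase when
    coefficients are replaced by 0 (ilim_suppress). There are two cases.

    If the sum of the first k basis vectors of the spreading model has norm at
    least c * k for every k, then convexity propagates this bound to
    nonnegative integer coefficients (ilim_nat), and suppression to all integer
    coefficients, with c / 2 in place of c (ilim_l1). Any finite set of integer
    vectors then satisfies almost the same bound on suitable terms of y
    (ilim_select), and letting this set grow gives a sequence with a lower
    l_1-estimate in the ultrapower of the range of y (ultra_l1). The range of y
    is relatively weakly compact (relatively_weakly_compact_null), so by
    assumption its ultrapower is too: a contradiction.

    Otherwise, for every r there is m r such that the sum of the first m r
    basis vectors of the spreading model has norm less than m r / (r + 1). A subsequence picked along U then has all its blocks of
    length m r, from the r-th term on, of norm less than m r / (r + 1)
    (block_subsequence), and its Cesaro means tend to 0 (cesaro_blocks).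

    The only functionals needed are subgradients of convex Lipschitz functions:
    of the distance to a convex set for Mazur's theorem, of the norm for norming
    functionals, and of the iterated limits for ilim_suppress. *)

(** * The Hahn-Banach theorem in subgradient form *)

Section Sublinear.
Variables (R : realType) (V : lmodType R).

Definition sublinear (q : V -> R) :=
  (forall u v, q (u + v) <= q u + q v) /\
  (forall a u, 0 < a -> q (a *: u) <= a * q u).

Lemma sublinearZ q a u : sublinear q -> 0 < a -> q (a *: u) = a * q u.
Proof.
move=> [_ qZ] a0; apply/eqP; rewrite eq_le qZ//=.
have a'0 : 0 < a^-1 by rewrite invr_gt0.
have := qZ a^-1 (a *: u) a'0.
by rewrite scalerA mulVf ?gt_eqF// scale1r ler_pdivlMl.
Qed.

Lemma sublinear0 q : sublinear q -> q 0 = 0.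
Proof.
by move=> qs; have := @sublinearZ q 2 0 qs; rewrite scaler0 ltr0n => /(_ isT); lra.
Qed.

Lemma sublinear_geN q u : sublinear q -> - q (- u) <= q u.
Proof.
by move=> qs; have := qs.1 u (- u); rewrite subrr sublinear0//; lra.
Qed.

(** The lower bounds of chains required by Zorn's lemma. The bound by p keeps
    the infimum finite, since each q is at least - p (- v) at v. *)
Lemma sublinear_inf (p : V -> R) (S : set (V -> R)) : S !=set0 ->
  (forall q, S q -> sublinear q /\ forall v, q v <= p v) ->
  (forall q r, S q -> S r ->
     (forall v, q v <= r v) \/ (forall v, r v <= q v)) ->
  exists2 q0, sublinear q0 & forall q, S q -> forall v, q0 v <= q v.
Proof.
move=> [q1 Sq1] SP Stot.
pose q0 v := inf [set q v | q in S].
have q0i v : has_inf [set q v | q in S].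
  split; first by exists (q1 v), q1.
  exists (- p (- v)) => _ [q Sq <-].
  have [qs qp] := SP q Sq.
  by rewrite (le_trans _ (sublinear_geN _ qs))// lerN2.
have q0le q v : S q -> q0 v <= q v.
  by move=> Sq; apply: ge_inf; [exact: (q0i v).2|exists q].
exists q0 => [|q Sq v]; last exact: q0le.
split=> [u v|a u a0].
  apply/ler_addgt0Pr => e e0; have e20 : 0 < e / 2 by lra.
  have [_ [q Sq <-] qe] := inf_adherent e20 (q0i u).
  have [_ [r Sr <-] re] := inf_adherent e20 (q0i v).
  rewrite -/(q0 u) -/(q0 v) in qe re.
  have [qr|rq] := Stot q r Sq Sr.
    have := q0le q (u + v) Sq; have := (SP q Sq).1.1 u v; have := qr v; lra.
  have := q0le r (u + v) Sr; have := (SP r Sr).1.1 u v; have := rq u; lra.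
rewrite -ler_pdivrMl//; apply: lb_le_inf => [|_ [q Sq <-]].
  by exists (q1 u), q1.
rewrite ler_pdivrMl//.
by rewrite (le_trans (q0le q _ Sq))//; exact: (SP q Sq).1.2.
Qed.

(** Moving in the direction u and paying q u per unit of length lowers the
    value at - u to - q u: a minimal q must therefore be odd. *)
Lemma sublinear_lower q u : sublinear q ->
  exists2 r, sublinear r & (forall v, r v <= q v) /\ r (- u) <= - q u.
Proof.
move=> qs; have [qD qZ] := qs.
pose F v := [set q (v + t *: u) - t * q u | t in [set t : R | 0 <= t]].
have Fi v : has_inf (F v).
  split; first by exists (q (v + 0 *: u) - 0 * q u), 0 => /=.
  exists (- q (- v)) => _ [t /= t0 <-].
  have : t * q u = q (t *: u).
    have [->|tn0] := eqVneq t 0; first by rewrite mul0r scale0r sublinear0.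
    by rewrite sublinearZ// lt_def tn0.
  by have := qD (v + t *: u) (- v); rewrite addrAC subrr add0r; lra.
have Fle v t : 0 <= t -> inf (F v) <= q (v + t *: u) - t * q u.
  by move=> t0; apply: ge_inf; [exact: (Fi v).2|exists t].
exists (fun v => inf (F v)); last first.
  split=> [v|]; first by have := Fle v 0 (lexx _); rewrite scale0r addr0 mul0r subr0.
  by have := Fle (- u) 1 ler01; rewrite scale1r addNr sublinear0// mul1r sub0r.
split=> [v w|a v a0].
  apply/ler_addgt0Pr => e e0; have e20 : 0 < e / 2 by lra.
  have [_ [s /= s0 <-] se] := inf_adherent e20 (Fi v).
  have [_ [t /= t0 <-] te] := inf_adherent e20 (Fi w).
  have := Fle (v + w) (s + t) (addr_ge0 s0 t0).
  rewrite scalerDl addrACA; have := qD (v + s *: u) (w + t *: u).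
  lra.
rewrite -ler_pdivrMl//; apply: lb_le_inf => [|_ [t /= t0 <-]].
  by exists (q (v + 0 *: u) - 0 * q u), 0 => /=.
rewrite ler_pdivrMl//.
have at0 : 0 <= a * t by rewrite mulr_ge0 // ltW.
have := Fle (a *: v) (a * t) at0.
rewrite -scalerA -scalerDr sublinearZ// mulrBr; lra.
Qed.

(** A minimal sublinear functional below p, which exists by Zorn's lemma, is
    linear: no extension of functionals from subspaces is involved. *)
Lemma linear_below (p : V -> R) : sublinear p ->
  exists2 f : V -> R, linear (f : V -> R^o) & forall v, f v <= p v.
Proof.
move=> ps.
pose T := {q : V -> R | sublinear q /\ forall v, q v <= p v}.
pose rel_ (q r : T) := `[< forall v, sval r v <= sval q v >].
have [|||A Atot|[q [qs qp]] qmin] := @Zorn T rel_.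
- by move=> t; apply/asboolP.
- move=> r s t /asboolP rs /asboolP st; apply/asboolP => v.
  exact: le_trans (st v) (rs v).
- move=> [s sP] [t tP] /asboolP /= st /asboolP /= ts.
  have e : s = t by apply/funext => v; apply/eqP; rewrite eq_le st ts.
  by move: sP tP st ts; rewrite e => sP tP _ _; congr exist; exact: Prop_irrelevance.
- have [[q1 Aq1]|A0] := pselect (A !=set0); last first.
    exists (exist _ p (conj ps (fun v => lexx (p v)))) => s As.
    by exfalso; apply: A0; exists s.
  pose S := [set q | exists2 r : T, A r & q = sval r].
  have [|q [r Ar ->]|q r [q' Aq ->] [r' Ar ->]|q0 q0s q0S] := @sublinear_inf p S.
  + by exists (sval q1), q1.
  + exact: (svalP r).
  + by have [/asboolP ?|/asboolP ?] := Atot q' r' Aq Ar; [right|left].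
  have q0p v : q0 v <= p v.
    apply: le_trans (q0S (sval q1) _ v) _; first by exists q1.
    exact: (svalP q1).2.
  exists (exist _ q0 (conj q0s q0p)) => s As; apply/asboolP => v /=.
  by apply: q0S; exists s.
have qN u : q (- u) = - q u.
  have [r rs [rq ru]] := sublinear_lower u qs.
  have rp v : r v <= p v by exact: le_trans (rq v) (qp v).
  have /(congr1 sval)/= rE := qmin (exist _ r (conj rs rp)) (asboolT rq).
  rewrite rE in ru; have := sublinear_geN (- u) qs; rewrite opprK.
  by move=> ?; apply/eqP; rewrite eq_le ru.
have qD u v : q (u + v) = q u + q v.
  apply/eqP; rewrite eq_le qs.1/=.
  by have := qs.1 (- u) (- v); rewrite -opprD !qN; lra.
exists q => // a u v; rewrite qD; congr (_ + _).
have [a0|a0|->] := ltrgt0P a.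
- exact: sublinearZ.
- rewrite -[a]opprK scaleNr qN sublinearZ ?oppr_gt0//.
  by rewrite -[RHS]/(- - a * q u) mulNr.
- by rewrite !scale0r sublinear0.
Qed.

End Sublinear.

Section Subgradient.
Variables (R : realType) (V : normedModType R).

Definition convex_fun (g : V -> R) := forall t u v, 0 <= t <= 1 ->
  g (t *: u + (1 - t) *: v) <= t * g u + (1 - t) * g v.

Definition lipschitz_fun (C : R) (g : V -> R) :=
  forall u v, g u - g v <= C * `|u - v|.

(** Bounded linear forms are kept as plain functions with an explicit bound, so
    that sums and pointwise limits of them are immediate; functional_dual
    turns them into elements of the dual. *)
Definition functional (C : R) (f : V -> R) :=
  linear (f : V -> R^o) /\ forall v, f v <= C * `|v|.

Lemma functional_dual C f : functional C f -> exists F : dual V, sval F =1 f.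
Proof.
move=> [fl fC].
pose b := GRing.isLinear.Build R V R^o *:%R f fl.
pose F : {linear V -> R^o} := HB.pack f b.
suff Fc : continuous F by exists (exist _ F Fc).
apply: bounded_linear_continuous; apply/linear_boundedP.
exists `|C|; split; first by rewrite realE normr_ge0.
move=> M CM v.
have h w : f w <= M * `|w|.
  rewrite (le_trans (fC w))// ler_wpM2r// (le_trans (ler_norm C))//.
  exact: ltW.
rewrite ler_norml h lerNl andbT.
have -> : - F v = F (- v) by rewrite linearN.
by rewrite (le_trans (h _))// normrN.
Qed.

(** The directional derivative of a convex function at p is sublinear, and a
    linear form below it is a subgradient. *)
Lemma subgradient (C : R) (g : V -> R) (p : V) :
  convex_fun g -> lipschitz_fun C g ->
  exists2 f, functional C f & forall v, g p + f (v - p) <= g v.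
Proof.
move=> gc gC.
pose F v := [set s * (g (p + s^-1 *: v) - g p) | s in [set s : R | 0 < s]].
have Fi v : has_inf (F v).
  split; first by exists (1 * (g (p + 1^-1 *: v) - g p)), 1 => //=; exact: ltr01.
  exists (- (C * `|v|)) => _ [s /= s0 <-].
  have := gC p (p + s^-1 *: v); rewrite opprD addrA subrr add0r normrN normrZ.
  rewrite gtr0_norm ?invr_gt0// mulrCA -ler_pdivrMl ?invr_gt0// invrK; lra.
have Fle v s : 0 < s -> inf (F v) <= s * (g (p + s^-1 *: v) - g p).
  by move=> s0; apply: ge_inf; [exact: (Fi v).2|exists s].
have Fs : sublinear (fun v => inf (F v)).
  split=> [v w|a v a0].
    apply/ler_addgt0Pr => e e0; have e20 : 0 < e / 2 by lra.
    have [_ [s /= s0 <-] se] := inf_adherent e20 (Fi v).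
    have [_ [t /= t0 <-] te] := inf_adherent e20 (Fi w).
    have st0 : 0 < s + t by lra.
    have := Fle (v + w) (s + t) st0.
    have := gc (s / (s + t)) (p + s^-1 *: v) (p + t^-1 *: w).
    have -> : 1 - s / (s + t) = t / (s + t) by field; lra.
    have -> : (s / (s + t)) *: (p + s^-1 *: v) + (t / (s + t)) *: (p + t^-1 *: w)
              = p + (s + t)^-1 *: (v + w).
      rewrite !scalerDr !scalerA addrACA -scalerDl -mulrDl mulfV ?gt_eqF//.
      rewrite scale1r; congr (_ + (_ *: _ + _ *: _)); field; lra.
    have -> : 0 <= s / (s + t) <= 1.
      apply/andP; split; first by rewrite divr_ge0// ltW.
      by rewrite ler_pdivrMr// mul1r lerDl ltW.
    move=> /(_ isT); rewrite -(ler_pM2l st0).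
    have -> : (s + t) * (s / (s + t) * g (p + s^-1 *: v) +
       t / (s + t) * g (p + t^-1 *: w))
       = s * g (p + s^-1 *: v) + t * g (p + t^-1 *: w) by field; lra.
    lra.
  rewrite -ler_pdivrMl//; apply: lb_le_inf => [|_ [s /= s0 <-]].
    by exists (1 * (g (p + 1^-1 *: v) - g p)), 1 => //=; exact: ltr01.
  rewrite ler_pdivrMl//.
  have := Fle (a *: v) (a * s) (mulr_gt0 a0 s0).
  have -> : (a * s)^-1 *: (a *: v) = s^-1 *: v.
    by rewrite scalerA; congr (_ *: _); field; rewrite !gt_eqF.
  by rewrite mulrA.
have [f fl fF] := linear_below Fs.
have fg v : f v <= g (p + v) - g p.
  by have := Fle v 1 ltr01; rewrite invr1 scale1r mul1r; exact: le_trans (fF v).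
exists f => [|v]; last by have := fg (v - p); rewrite [p + _]addrC subrK; lra.
split=> // v; apply: le_trans (fg v) _.
by have := gC (p + v) p; rewrite addrAC subrr add0r.
Qed.

Lemma functionalN C f v : functional C f -> f (- v) = - f v.
Proof.
move=> [fl _]; have f0 : f 0 = 0.
  by have := fl 1 0 0; rewrite scale1r addr0 /= -[_ *: _]/(1 * f 0) mul1r; lra.
by have := fl (-1) v 0; rewrite addr0 scaleN1r f0 addr0 scaleN1r.
Qed.

Lemma functionalB C f u v : functional C f -> f (u - v) = f u - f v.
Proof.
move=> fC; have := fC.1 1 u (- v).
by rewrite scale1r -[1 *: _]/(1 * f u) mul1r (functionalN _ fC).
Qed.

Lemma functional_norm C f v : functional C f -> `|f v| <= C * `|v|.
Proof.
move=> fC; rewrite ler_norml (fC.2 v) andbT lerNl -(functionalN _ fC).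
by rewrite -[`|v|]normrN; exact: fC.2.
Qed.

Lemma convex_norm : convex_fun (fun v : V => `|v|).
Proof.
move=> t u v /andP[t0 t1]; rewrite (le_trans (ler_normD _ _))// !normrZ.
by rewrite !ger0_norm// subr_ge0.
Qed.

Lemma lipschitz_norm : lipschitz_fun 1 (fun v : V => `|v|).
Proof.
by move=> u v; rewrite mul1r; exact: le_trans (ler_norm _) (ler_dist_dist _ _).
Qed.

Lemma norming_functional (p : V) : exists2 f, functional 1 f & f p = `|p|.
Proof.
have [f ff fp] := subgradient p convex_norm lipschitz_norm.
exists f => //; apply/eqP; rewrite eq_le.
have := fp 0; rewrite normr0 sub0r (functionalN _ ff).
by have := ff.2 p; rewrite mul1r => ->; lra.
Qed.

End Subgradient.

(** * Weak topology, Mazur's theorem and relatively weakly compact sets *)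

Section Weak.
Variables (R : realType) (V : normedModType R).

Lemma weak_nbhs (f : dual V) (p : V) (e : R) : 0 < e ->
  nbhs (p : weak V) [set v | `|sval f v - sval f p| < e].
Proof.
move=> e0.
have pp : (nbhs (p : weak V) : set_system V) --> (p : weak V) by [].
have /cvg_sup/(_ f) H := pp; apply: H => /=.
have := @initial_continuous _ _ (sval f : V -> R^o) p.
move/cvgr_dist_lt => /(_ _ e0); apply: filterS => v /=.
by rewrite distrC.
Qed.

Lemma weak_cvg (F : set_system V) (p : V) : Filter F ->
  (forall (f : dual V) (e : R), 0 < e -> F [set v | `|sval f v - sval f p| < e]) ->
  F --> (p : weak V).
Proof.
move=> FF Ff; apply/cvg_sup => f A /=.
move=> [_ [[B Bo <-] Bp BA]]; apply: filterS BA _.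
have : nbhs (sval f p : R^o) B by exact: open_nbhs_nbhs.
move=> /nbhs_ballP[e e0 eB]; apply: filterS (Ff f e e0) => v /= vp.
by apply: eB; rewrite /ball /= distrC.
Qed.

Lemma functional_closure (C : R) (f : V -> R) (A : set V) (p : V) (e : R) :
  functional C f -> closure (A : set (weak V)) p -> 0 < e ->
  exists2 v, A v & `|f v - f p| < e.
Proof.
move=> /functional_dual[F Ff] Ap e0.
have [v [Av /= vp]] := Ap _ (weak_nbhs F p e0).
by exists v => //; rewrite -!Ff.
Qed.

Lemma weak_hausdorff : hausdorff_space (weak V).
Proof.
move=> p q pq; apply: contrapT => /eqP pNq.
have d0 : 0 < `|p - q| by rewrite normr_gt0 subr_eq0.
have [f ff fpq] := norming_functional (p - q).
have [F Ff] := functional_dual ff.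
have d20 : 0 < `|p - q| / 2 by lra.
have [v [/= vp vq]] := pq _ _ (weak_nbhs F p d20) (weak_nbhs F q d20).
rewrite (functionalB _ _ ff) in fpq; rewrite !Ff in vp vq.
move: vp vq; rewrite !ltr_norml => /andP[vp1 vp2] /andP[vq1 vq2].
by move: d20 vp1 vp2 vq1 vq2; rewrite -fpq; lra.
Qed.

Definition convex_subset (C : set V) := forall t u v, 0 <= t <= 1 ->
  C u -> C v -> C (t *: u + (1 - t) *: v).

(** The distance to C is a convex function vanishing on C, and so is at most 0
    at every point of the weak closure. *)
Lemma mazur (C : set V) (p : V) (e : R) : convex_subset C ->
  closure (C : set (weak V)) p -> 0 < e -> exists2 u, C u & `|p - u| < e.
Proof.
move=> Cc Cp e0.
have [u0 [Cu0 _]] := Cp setT filterT.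
pose D v := [set `|v - u| | u in C].
have Di v : has_inf (D v).
  split; first by exists `|v - u0|, u0.
  by exists 0 => _ [u _ <-].
have Dle u v : C u -> inf (D v) <= `|v - u|.
  by move=> Cu; apply: ge_inf; [exact: (Di v).2|exists u].
have gc : convex_fun (fun v => inf (D v)).
  move=> t u v t01; have /andP[t0 t1] := t01.
  apply/ler_addgt0Pr => d d0.
  have [_ [u' /= u'C <-] u'd] := inf_adherent d0 (Di u).
  have [_ [v' /= v'C <-] v'd] := inf_adherent d0 (Di v).
  apply: le_trans (Dle _ _ (Cc _ _ _ t01 u'C v'C)) _.
  have -> : t *: u + (1 - t) *: v - (t *: u' + (1 - t) *: v') =
            t *: (u - u') + (1 - t) *: (v - v').
    by rewrite !scalerBr opprD addrACA.
  rewrite (le_trans (ler_normD _ _))// !normrZ !ger0_norm ?subr_ge0//.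
  have -> : t * inf (D u) + (1 - t) * inf (D v) + d =
            t * (inf (D u) + d) + (1 - t) * (inf (D v) + d) by ring.
  by rewrite lerD// ler_wpM2l ?subr_ge0// ltW.
have gl : lipschitz_fun 1 (fun v => inf (D v)).
  move=> u v; rewrite mul1r lerBlDr; apply/ler_addgt0Pr => d d0.
  have [_ [v' /= v'C <-] v'd] := inf_adherent d0 (Di v).
  apply: le_trans (Dle _ _ v'C) _; rewrite -[u](subrK v) -addrA.
  by rewrite (le_trans (ler_normD _ _))// addrK -addrA lerD2l ltW.
have [f ff fg] := subgradient p gc gl.
have [v Cv vp] := functional_closure ff Cp e0.
have Dv : inf (D v) <= 0 by have := Dle v v Cv; rewrite subrr normr0.
have Dp : inf (D p) < 0 + e.
  have := fg v; rewrite (functionalB _ _ ff); move: vp; rewrite ltr_norml; lra.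
rewrite add0r in Dp.
have : 0 < e - inf (D p) by lra.
move=> /inf_adherent/(_ (Di p)) [_ [u Cu <-] ue]; exists u => //.
by move: ue; lra.
Qed.

Lemma sum_ord_pad (W : nmodType) (F : nat -> W) n m : (n <= m)%N ->
  (forall k, (n <= k)%N -> F k = 0) -> \sum_(k < m) F k = \sum_(k < n) F k.
Proof.
move=> nm F0; rewrite (big_ord_widen m F nm) [RHS]big_mkcond.
by apply: eq_bigr => k _; case: ltnP => // nk; rewrite F0.
Qed.

(** A weak cluster point of the sequence lies, by Mazur's theorem, in the norm
    closures of the affine spans of all its tails; the lower bound keeps
    affine combinations with disjoint supports apart. *)
Lemma l1_not_relatively_weakly_compact (A : set V) (x : nat -> V) (c : R) :
  0 < c -> (forall n, A (x n)) ->
  (forall n (a : nat -> R), c * \sum_(k < n) `|a k| <= `|\sum_(k < n) a k *: x k|) ->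
  ~ relatively_weakly_compact A.
Proof.
move=> c0 Ax xc Ac.
have FA : (x @ \oo) (closure (A : set (weak V))).
  by exists 0%N => // n _; exact: (@subset_closure (weak V) A _ (Ax n)).
have [p [_ xp]] := Ac _ (fmap_proper_filter _ _) FA.
pose D N : set V := [set u | exists n a,
  [/\ forall k, (k < N)%N -> a k = 0, forall k, (n <= k)%N -> a k = 0,
   \sum_(k < n) a k = 1 & u = \sum_(k < n) a k *: x k]].
have pad n m (a : nat -> R) : (n <= m)%N -> (forall k, (n <= k)%N -> a k = 0) ->
    (\sum_(k < m) a k = \sum_(k < n) a k) *
    (\sum_(k < m) a k *: x k = \sum_(k < n) a k *: x k).
  move=> nm a0; split; first exact: sum_ord_pad nm a0.
  apply: (@sum_ord_pad _ (fun k => a k *: x k)) => // k nk.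
  by rewrite a0// scale0r.
have Dc N : convex_subset (D N).
  move=> t u v _ [n [a [aN an a1 ->]]] [m [b [bN bm b1 ->]]].
  exists (maxn n m), (fun k => t * a k + (1 - t) * b k); split.
  - by move=> k kN; rewrite aN// bN// !mulr0 addr0.
  - by move=> k; rewrite geq_max => /andP[nk mk]; rewrite an// bm// !mulr0 addr0.
  - rewrite big_split/= -!mulr_sumr (pad _ _ _ (leq_maxl n m) an).
    by rewrite (pad _ _ _ (leq_maxr n m) bm) a1 b1; ring.
  - rewrite -(pad _ _ _ (leq_maxl n m) an) -(pad _ _ _ (leq_maxr n m) bm).
    rewrite !scaler_sumr -big_split/=; apply: eq_bigr => k _.
    by rewrite !scalerA -scalerDl.
have Dp N : closure (D N : set (weak V)) p.
  move=> B Bp; apply: xp => //; exists N => // k /= Nk.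
  exists k.+1, (fun i => (i == k)%:R); split.
  - by move=> i iN; case: eqP => // ik; move: iN; rewrite ik ltnNge Nk.
  - by move=> i ki; rewrite gtn_eqF.
  - by rewrite big_ord_recr/= eqxx big1 ?add0r// => i _; rewrite ltn_eqF.
  - rewrite big_ord_recr/= eqxx scale1r big1 ?add0r// => i _.
    by rewrite ltn_eqF// scale0r.
have c20 : 0 < c / 2 by lra.
(* v is supported beyond the support of u *)
have [u [n [a [_ an a1 uE]]] pu] := mazur (Dc 0%N) (Dp 0%N) c20.
have [v [m [b [bn bm b1 vE]]] pv] := mazur (Dc n) (Dp n) c20.
have : `|u - v| < c.
  have -> : u - v = (p - v) - (p - u) by rewrite opprB [RHS]addrC addrA subrK.
  by rewrite (le_lt_trans (ler_normB _ _))//; lra.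
apply/negP; rewrite -leNgt uE vE.
rewrite -(pad _ _ _ (leq_maxl n m) an) -(pad _ _ _ (leq_maxr n m) bm).
rewrite -sumrB; under eq_bigr do rewrite -scalerBl.
apply: le_trans (xc _ (fun k => a k - b k)); rewrite ler_pMr//.
rewrite -a1 -(pad _ _ _ (leq_maxl n m) an).
apply: ler_sum => k _; have [kn|nk] := ltnP k n.
  by rewrite bn// subr0 ler_norm.
by rewrite an.
Qed.

(** The sequence together with its limit 0 is weakly compact, hence weakly
    closed because functionals separate points. *)
Lemma relatively_weakly_compact_null (x : nat -> V) :
  (forall C f, functional C f -> f \o x @ \oo --> 0) ->
  relatively_weakly_compact (range x).
Proof.
move=> x0; pose B : set (weak V) := 0 |` range x.
have xcvg : (x : nat -> weak V) @ \oo --> (0 : weak V).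
  apply: weak_cvg => f e e0.
  have ff : exists C, functional C (sval f : V -> R).
    have /linear_boundedP[M [_ fM]] : bounded_near (sval f) (nbhs 0).
      by apply: continuous_linear_bounded; exact: (svalP f).
    exists (M + 1); split; first exact: linearP.
    by move=> v; apply: le_trans (ler_norm _) (fM _ _ v); rewrite ltrDl.
  have [C fC] := ff; have /cvgr0Pnorm_lt/(_ _ e0) := x0 _ _ fC.
  by apply: filterS => n /=; rewrite linear0 subr0.
have Bc : compact B.
  (* An ultrafilter on B avoiding a neighbourhood of 0 lives on a finite set. *)
  rewrite compact_ultra => F FU FB.
  have [F0|] := pselect (F --> (0 : weak V)); first by exists 0; split => //; left.
  move=> /existsNP[W /not_implyP[W0 FW]].
  have [//|FnW] := in_ultra_setVsetC W FU.
  have [N _ xN] := xcvg _ W0.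
  pose K : set (weak V) := x @` `I_N.
  have FK : F K.
    apply: filterS (filterI FB FnW) => _ [[->|[n _ <-]] nW].
      by have := nbhs_singleton W0.
    by exists n => //=; rewrite ltnNge; apply/negP => Nn; apply: nW; exact: xN.
  have : compact K by apply: finite_compact; exact/finite_image/finite_II.
  rewrite compact_ultra => /(_ F FU FK)[q [[n _ <-] Fq]].
  by exists (x n); split => //; right; exists n.
apply: (@subclosed_compact (weak V) _ B) => //.
  exact: (@closed_closure (weak V)).
have /closure_id -> : closed B by exact: compact_closed weak_hausdorff Bc.
by apply: (@closure_subset (weak V)) => v xv; right.
Qed.

End Weak.

Section UltraLimits.
Variables (R : realType) (F : set_system nat).
Hypothesis FU : UltraFilter F.

Lemma ultra_is_cvg (h : nat -> R) (M : R) : (forall n, `|h n| <= M) ->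
  cvg (h @ F).
Proof.
move=> hM.
have Mc : compact `[- M, M]%classic by exact: segment_compact.
have hF : (h @ F) `[- M, M]%classic.
  by apply: (@filterE _ F) => n /=; rewrite in_itv/= -ler_norml.
have [l [_ hl]] := Mc _ (fmap_proper_filter _ _) hF.
apply/cvg_ex; exists l => B Bl.
have [//|nB] := in_ultra_setVsetC (h @^-1` B) FU.
by have [z []] := hl (~` B) B nB Bl.
Qed.

End UltraLimits.
Section WeaklyCompactBounded.
Variables (R : realType) (V : normedModType R).

Lemma relatively_weakly_compact_functional (A : set V) (C : R) (f : V -> R) :
  relatively_weakly_compact A -> functional C f ->
  exists M, forall x, A x -> `|f x| <= M.
Proof.
move=> Ac fC; apply: contrapT => /forallNP nb.
have /choice[x xP] : forall n : nat, exists x, A x /\ n%:R < `|f x|.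
  move=> n; have /existsNP[x /not_implyP[Ax /negP]] := nb n%:R.
  by rewrite -ltNge => fx; exists x.
have xA : (x @ \oo) (closure (A : set (weak V))).
  by exists 0%N => // n _; exact: (@subset_closure (weak V) A _ (xP n).1).
have [p [_ xp]] := Ac _ (fmap_proper_filter _ _) xA.
have [F Ff] := functional_dual fC.
have pN : (x @ \oo) [set v | `|f p| + 1 < `|f v|].
  have [N _ NP] : \forall N \near \oo, `|f p| + 1 < N%:R by exact: nbhs_infty_gtr.
  exists N => // n /= Nn; apply: lt_trans (xP n).2; exact: NP.
have [v [/= pv vp]] := xp _ _ pN (weak_nbhs F p ltr01).
move: vp; rewrite !Ff => vp.
have := ler_normD (f v - f p) (f p); rewrite subrK; lra.
Qed.

Lemma cvg_dist_le (F : set_system nat) {FF : ProperFilter F} (h : nat -> R)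
    (l a c : R) : h @ F --> l -> F [set n | `|h n - a| <= c] -> `|l - a| <= c.
Proof.
move=> /cvgr_dist_lt hl hc; apply/ler_addgt0Pr => e e0.
have [n [/= n1 n2]] := filter_ex (filterI (hl e e0) hc).
have := ler_normD (l - h n) (h n - a); rewrite addrA subrK; lra.
Qed.

Lemma cvg_le (F : set_system nat) {FF : ProperFilter F} (h k : nat -> R)
    (l m : R) : h @ F --> l -> k @ F --> m -> (forall n, h n <= k n) -> l <= m.
Proof.
by move=> hl km hk; apply: ler_cvg_to hl km _; exact: filterE.
Qed.

(** The functionals are pointwise bounded on A by weak compactness, and a
    gliding hump contradicts this when A is unbounded: a functional is built as
    the sum of the +- 3 ^ - n g n, where g n norms a huge element x n of A and
    the sign is that of the value at x n of the previous partial sum. The later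
    terms cannot compensate the n-th one, so this functional is unbounded
    on A. *)
Lemma relatively_weakly_compact_bounded (A : set V) :
  relatively_weakly_compact A -> exists M, forall x, A x -> `|x| <= M.
Proof.
move=> Ac; apply: contrapT => /forallNP nb.
pose w n : R := 3^-1 ^+ n.
have w0 n : 0 < w n by rewrite exprn_gt0.
have wS n : w n.+1 = w n / 3 by rewrite /w exprSr.
have /choice[x xP] : forall n : nat, exists x, A x /\ n%:R < w n / 2 * `|x|.
  move=> n; have /existsNP[x /not_implyP[Ax /negP]] := nb (n%:R / (w n / 2)).
  by rewrite -ltNge ltr_pdivrMr ?divr_gt0// mulrC => fx; exists x.
have /choice[g gP] : forall n, exists g, functional 1 g /\ g (x n) = `|x n|.
  by move=> n; have [g g1 gx] := norming_functional (x n); exists g.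
pose f := fix f n : V -> R := if n isn't m.+1 then cst 0 else
  fun v => f m v + (if 0 <= f m (x m) then w m else - w m) * g m v.
have fl n : linear (f n : V -> R^o).
  elim: n => [|n IH] a u v /=; first by rewrite scaler0 addr0.
  rewrite IH (gP n).1.1 -[_ *: f n u]/(a * f n u) -[_ *: g n u]/(a * g n u).
  set e := (if _ then _ else _).
  by rewrite -[_ *: (_ : R^o)]/(a * (f n u + e * g n u)) /=; ring.
have fS n v : `|f n.+1 v - f n v| <= w n * `|v|.
  rewrite /= addrAC subrr add0r normrM.
  have -> : `|if 0 <= f n (x n) then w n else - w n| = w n.
    by case: ifP => _; rewrite ?normrN gtr0_norm.
  by rewrite ler_pM2l// -[leRHS]mul1r; exact: functional_norm (gP n).1.
have fx n : w n * `|x n| <= `|f n.+1 (x n)|.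
  rewrite /= (gP n).2; have : 0 <= w n * `|x n| by rewrite mulr_ge0// ltW.
  case: (leP 0 (f n (x n))) => h w0x; first by rewrite ger0_norm; lra.
  by rewrite mulNr ltr0_norm; lra.
have fD n d v : `|f (d + n)%N v - f n v| <= 3 / 2 * (w n - w (d + n)%N) * `|v|.
  elim: d => [|d IH]; first by rewrite !subrr normr0 mulr0 mul0r.
  rewrite addSn; have := fS (d + n)%N v; move: IH; rewrite wS.
  have := ler_normD (f (d + n).+1 v - f (d + n)%N v) (f (d + n)%N v - f n v).
  rewrite addrA subrK; lra.
have fM n v : `|f n v| <= 3 / 2 * `|v|.
  have := fD 0%N n v; rewrite addn0 /= subr0 => /le_trans; apply.
  rewrite ler_wpM2r//; have := w0 n; have -> : w 0%N = 1 by rewrite /w expr0.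
  lra.
have [U [UU ooU]] := @ultraFilterLemma _ \oo _.
pose fU v := lim (f n v @[n --> U]).
have fcvg v : f n v @[n --> U] --> fU v.
  exact: (ultra_is_cvg UU (fM^~ v)).
have fUf : functional (3 / 2) fU.
  split=> [a u v|v].
    apply: (cvg_lim (@Rhausdorff R)).
    under eq_fun do rewrite fl.
    by apply: cvgD => //; apply: cvgM => //; exact: cvg_cst.
  rewrite (le_trans (ler_norm _))// -[fU v]subr0.
  by apply: (cvg_dist_le (fcvg v)); apply: filterE => n /=; rewrite subr0.
have [M AM] := relatively_weakly_compact_functional Ac fUf.
have [N _ /(_ N (leqnn N)) MN] : \forall N \near \oo, M < N%:R by exact: nbhs_infty_gtr.
have : `|fU (x N) - f N.+1 (x N)| <= w N / 2 * `|x N|.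
  apply: (cvg_dist_le (fcvg (x N))); apply: ooU; exists N.+1 => // n /= Nn.
  have := fD N.+1 (n - N.+1)%N (x N); rewrite subnK// => /le_trans; apply.
  by rewrite ler_wpM2r// wS; have := w0 n; lra.
have := AM _ (xP N).1; have := fx N; have := (xP N).2.
have := ler_normD (fU (x N)) (- (fU (x N) - f N.+1 (x N))).
by rewrite opprB addrC subrK distrC; lra.
Qed.

Lemma relatively_weakly_compact_weakly_precompact (A : set V) :
  relatively_weakly_compact A -> weakly_precompact A.
Proof.
move=> Ac; split.
  have [M AM] := relatively_weakly_compact_bounded Ac.
  exists M; split; first exact: num_real.
  by move=> N /ltW MN x Ax; exact: le_trans (AM x Ax) MN.
move=> [x [Ax [c [C [c0 _ xc]]]]].
apply: (l1_not_relatively_weakly_compact c0 Ax _ Ac) => n a.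
by have /andP[] := xc n a.
Qed.

End WeaklyCompactBounded.

(** * Iterated limits along an ultrafilter *)

Section IteratedLimits.
Variables (R : realType) (V : normedModType R) (U : set_system nat).
Hypothesis UU : UltraFilter U.
Variables (y : nat -> V) (K : R).
Hypothesis yK : forall n, `|y n| <= K.

(** For s = [:: a1; ..; am] this is lim_n1 .. lim_nm of the norms of
    z + a1 *: y n1 + .. + am *: y nm, all limits being taken along U; at z = 0
    it is the norm of the spreading model of y. *)
Fixpoint ilim (s : seq R) (z : V) : R :=
  if s is a :: s' then lim (ilim s' (z + a *: y n) @[n --> U]) else `|z|.

Let bound (s : seq R) (z : V) := `|z| + K * \sum_(a <- s) `|a|.

Let K0 : 0 <= K. Proof. exact: le_trans (yK 0). Qed.

Let bound_cons a s z n : bound s (z + a *: y n) <= bound (a :: s) z.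
Proof.
rewrite /bound big_cons mulrDr addrA lerD2r (le_trans (ler_normD _ _))//.
by rewrite lerD2l normrZ mulrC ler_wpM2r.
Qed.

Let ilim_bound s z : `|ilim s z| <= bound s z.
Proof.
elim: s z => [|a s IH] z /=; first by rewrite /bound big_nil mulr0 addr0 normr_id.
have h n : `|ilim s (z + a *: y n)| <= bound (a :: s) z.
  exact: le_trans (IH _) (bound_cons _ _ _ _).
rewrite -[lim _]subr0; apply: (cvg_dist_le (ultra_is_cvg UU h)).
by apply: filterE => n /=; rewrite subr0.
Qed.

Lemma ilim_cvg a s z : ilim s (z + a *: y n) @[n --> U] --> ilim (a :: s) z.
Proof.
apply: (@ultra_is_cvg _ _ UU _ (bound (a :: s) z)) => n.
exact: le_trans (ilim_bound _ _) (bound_cons _ _ _ _).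
Qed.

Lemma ilim_cons_le a s t z : (forall u, ilim s u <= ilim t u) ->
  ilim (a :: s) z <= ilim (a :: t) z.
Proof.
by move=> st; apply: (cvg_le (@ilim_cvg a s z) (@ilim_cvg a t z)) => n.
Qed.

Lemma ilim_cons0 s z : ilim (0 :: s) z = ilim s z.
Proof.
rewrite /=; under eq_fun do rewrite scale0r addr0.
exact: (lim_cst (@Rhausdorff R)).
Qed.

Lemma ilim_lipschitz s : lipschitz_fun 1 (ilim s).
Proof.
elim: s => [|a s IH] u v; first exact: lipschitz_norm.
rewrite lerBlDl addrC.
apply: (cvg_le (@ilim_cvg a s u) (cvgD (cvg_cst _) (@ilim_cvg a s v))).
move=> n /=; rewrite -lerBlDr (le_trans (IH _ _))//.
by rewrite opprD addrACA subrr addr0.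
Qed.

Lemma ilim_convex s : convex_fun (ilim s).
Proof.
elim: s => [|a s IH] t u v t01; first exact: convex_norm.
apply: (cvg_le (@ilim_cvg a s _)
  (cvgD (cvgMl_tmp (@ilim_cvg a s u)) (cvgMl_tmp (@ilim_cvg a s v)))).
move=> n /=.
have -> : t *: u + (1 - t) *: v + a *: y n =
   t *: (u + a *: y n) + (1 - t) *: (v + a *: y n).
  by rewrite !scalerDr addrACA -scalerDl [t + _]addrC subrK scale1r.
exact: IH.
Qed.

Lemma ilimN s z : ilim (map -%R s) (- z) = ilim s z.
Proof.
elim: s z => [|a s IH] z /=; first by rewrite normrN.
by under eq_fun do rewrite scaleNr -opprD IH.
Qed.

(** The vector with a and b in two consecutive positions is a convex combination
    of those with a + b in one of the positions and 0 in the other, and the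
    position of a 0 does not matter. *)
Lemma ilim_split a b s z : 0 <= a -> 0 < b ->
  ilim [:: a, b & s] z <= ilim (a + b :: s) z.
Proof.
move=> a0 b0; have ab0 : 0 < a + b by lra.
pose t := a / (a + b); pose L := ilim (a + b :: s) z.
have t01 : 0 <= t <= 1.
  apply/andP; split; first by rewrite divr_ge0// ltW.
  by rewrite ler_pdivrMr// mul1r lerDl ltW.
pose G n := ilim s (z + (a + b) *: y n).
have GL : G n @[n --> U] --> L by exact: ilim_cvg.
rewrite -/L; have -> : L = t * L + (1 - t) * L by ring.
apply: (cvg_le (@ilim_cvg a (b :: s) z)
  (cvgD (cvgMl_tmp GL) (cvg_cst ((1 - t) * L)))).
move=> n.
apply: (cvg_le (@ilim_cvg b s (z + a *: y n))
  (cvgD (cvg_cst (t * G n)) (cvgMl_tmp GL))).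
move=> k /=.
have -> : z + a *: y n + b *: y k =
   t *: (z + (a + b) *: y n) + (1 - t) *: (z + (a + b) *: y k).
  rewrite !scalerDr addrACA -scalerDl [t + _]addrC subrK scale1r !scalerA addrA.
  by congr (_ + _ *: _ + _ *: _); rewrite /t; field; lra.
exact: ilim_convex.
Qed.

(** Splitting off one unit at a time. *)
Lemma ilim_nat ns z :
  ilim (nseq (sumn ns) 1) z <= ilim (map (fun p : nat => p%:R) ns) z.
Proof.
elim: ns z => [//|p ns IH] z; elim: p z => [|p IHp] z; first by rewrite ilim_cons0.
apply: le_trans (ilim_cons_le 1 z IHp) _.
rewrite -[leRHS]/(ilim (p.+1%:R :: map (fun q : nat => q%:R) ns) z) -nat1r.
case: p {IHp} => [|p]; last by apply: ilim_split; rewrite ?ler01 ?ltr0n.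
by rewrite addr0; apply: ilim_cons_le => u; rewrite -[leRHS]ilim_cons0.
Qed.

(** A strict lower bound on an iterated limit survives for U-almost all choices
    of the first index, hence for one choice common to finitely many bounds. *)
Lemma ilim_select (I : finType) m (s : I -> seq R) (z : I -> V) (b : I -> R) :
  (forall i, (size (s i) <= m)%N) -> (forall i, b i < ilim (s i) (z i)) ->
  exists t : nat -> nat, forall i,
    b i < `|z i + \sum_(j < size (s i)) (s i)`_j *: y (t j)|.
Proof.
elim: m s z => [|m IH] s z sm bs.
  exists id => i; have := bs i; have := sm i.
  by rewrite leqn0 size_eq0 => /eqP ->; rewrite big_ord0 addr0.
have [n sn] : exists n, forall i,
    b i < ilim (behead (s i)) (z i + head 0 (s i) *: y n).
  apply: (@filter_ex _ U); apply: filter_forall => i.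
  have := bs i; case: (s i) => [|a s'] bi.
    by apply: filterE => n; rewrite scale0r addr0.
  exact: cvgr_gt (@ilim_cvg a s' (z i)) _ bi.
have [i|t tP] := IH (fun i => behead (s i)) _ _ sn.
  by rewrite size_behead; have := sm i; case: (size _).
exists (fun j => if j is j'.+1 then t j' else n) => i; have := tP i.
case: (s i) => [|a s'] /=; first by rewrite !big_ord0 scale0r addr0.
by rewrite big_ord_recl addrA.
Qed.

Hypothesis ynull : forall C f, functional C f -> f \o y @ U --> 0.

(** Since y is weakly null, a subgradient at 0 of the convex function
    v |-> ilim s (z + a *: v) has limit 0 along y: dropping the first
    coefficient cannot increase the norm. *)
Lemma ilim_suppress a s z : ilim s z <= ilim (a :: s) z.
Proof.
pose g v := ilim s (z + a *: v).
have gc : convex_fun g.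
  move=> t u v t01; rewrite /g.
  have -> : z + a *: (t *: u + (1 - t) *: v) =
     t *: (z + a *: u) + (1 - t) *: (z + a *: v).
    rewrite !scalerDr addrACA -scalerDl [t + _]addrC subrK scale1r.
    by rewrite !scalerA ![a * _]mulrC.
  exact: ilim_convex.
have gl : lipschitz_fun `|a| g.
  move=> u v; rewrite (le_trans (ilim_lipschitz _ _ _))// mul1r.
  by rewrite opprD addrACA subrr add0r -scalerBr normrZ.
have [f ff fg] := subgradient 0 gc gl.
have -> : ilim s z = g 0 + 0 by rewrite /g scaler0 !addr0.
apply: (cvg_le (cvgD (cvg_cst (g 0)) (ynull ff)) (@ilim_cvg a s z)).
by move=> n; have := fg (y n); rewrite subr0.
Qed.

Let pos (i : int) : nat := if i is Posz n then n else 0.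

Let ilim_pos (s : seq int) z :
  ilim (map (fun p : nat => p%:R) (map pos s)) z <= ilim (map intr s) z.
Proof.
elim: s z => [//|[n|n] s IH] z; first exact: ilim_cons_le.
rewrite [map pos _]/= [map _ (_ :: _)]/= ilim_cons0.
exact: le_trans (IH z) (ilim_suppress _ _ _).
Qed.

(** Suppression reduces the estimate to the positive part of s and, by symmetry,
    to its negative part; averaging the two costs the factor 2. *)
Lemma ilim_l1 (c : R) (s : seq int) : 0 <= c ->
  (forall k, c * k%:R <= ilim (nseq k 1) 0) ->
  c / 2 * \sum_(i <- s) `|i|%:~R <= ilim (map intr s) 0.
Proof.
move=> c0 ck.
have pos_le (t : seq int) : c * (sumn (map pos t))%:R <= ilim (map intr t) 0.
  exact: le_trans (ck _) (le_trans (ilim_nat _ _) (ilim_pos _ _)).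
have sN : ilim (map intr (map -%R s)) 0 = ilim (map intr s) 0.
  rewrite -[RHS]ilimN oppr0 -!map_comp; congr (ilim _ 0).
  by apply: eq_map => i /=; rewrite rmorphN.
have -> : \sum_(i <- s) (`|i|%:~R : R) =
    (sumn (map pos s))%:R + (sumn (map pos (map -%R s)))%:R.
  elim: s {sN} => [|i s IH]; first by rewrite big_nil addr0.
  rewrite big_cons IH /= !natrD addrACA; congr (_ + _).
  by case: i => [[|n]|n] /=; rewrite ?add0r ?addr0.
have := pos_le s; have := pos_le (map -%R s); rewrite sN; lra.
Qed.

End IteratedLimits.

(** * Cesaro means *)

Section Cesaro.
Variables (R : realType) (V : normedModType R).

Lemma norm_sum_le (y : nat -> V) (K : R) a d : (forall n, `|y n| <= K) ->
  `|\sum_(a <= i < a + d) y i| <= K * d%:R.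
Proof.
move=> yK; elim: d => [|d IH]; first by rewrite addn0 big_geq// normr0 mulr0.
rewrite addnS big_nat_recr ?leq_addr//= (le_trans (ler_normD _ _))//.
by rewrite -natr1 mulrDr mulr1 lerD.
Qed.

(** If the blocks of length m r starting at r or later have averages of norm at
    most 1 / (r + 1), only the first r terms and an incomplete last block
    escape this bound. *)
Lemma cesaro_blocks (y : nat -> V) (K : R) (m : nat -> nat) :
  (forall n, `|y n| <= K) -> (forall r, 0 < m r)%N ->
  (forall r k, (r <= k)%N ->
     `|\sum_(k <= i < k + m r) y i| <= (m r)%:R / r.+1%:R) ->
  n.+1%:R^-1 *: \sum_(k < n.+1) y k @[n --> \oo] --> (0 : V).
Proof.
move=> yK m0 ym; have K0 : 0 <= K by exact: le_trans (yK 0%N).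
have tail r k d : (r <= k)%N ->
    `|\sum_(k <= i < k + d) y i| <= K * (m r)%:R + d%:R / r.+1%:R.
  have [b db] : exists b, (d <= b)%N by exists d.
  elim: b d db k => [|b IH] d db k rk.
    move: db; rewrite leqn0 => /eqP ->; rewrite addn0 big_geq// normr0 mul0r addr0.
    by rewrite mulr_ge0.
  have [dm|md] := ltnP d (m r).
    apply: le_trans (norm_sum_le _ _ yK) _.
    rewrite ler_wpDr ?divr_ge0//; apply: ler_wpM2l => //.
    by rewrite ler_nat ltnW.
  rewrite (@big_cat_nat _ _ _ (k + m r)) ?leq_addr ?leq_add2l//=.
  have -> : (k + d = (k + m r) + (d - m r))%N by rewrite -addnA subnKC.
  apply: le_trans (ler_normD _ _) _.
  have dmb : (d - m r <= b)%N by have := m0 r; lia.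
  have := IH (d - m r)%N dmb (k + m r)%N (leq_trans rk (leq_addr _ _)).
  have := ym r k rk; rewrite natrB// mulrBl.
  by move: ((m r)%:R / _) (d%:R / _) => s t; lra.
have all_ r N : `|\sum_(0 <= i < N) y i| <= K * (r + m r)%:R + N%:R / r.+1%:R.
  have [Nr|rN] := ltnP N r.
    apply: le_trans (norm_sum_le 0%N N yK) _.
    rewrite ler_wpDr ?divr_ge0//; apply: ler_wpM2l => //.
    by rewrite ler_nat; lia.
  rewrite (@big_cat_nat _ _ _ r)//= (le_trans (ler_normD _ _))//.
  rewrite natrD mulrDr -addrA lerD//; first exact: (norm_sum_le 0%N r yK).
  have := tail r r (N - r)%N (leqnn r); rewrite subnKC// => /le_trans; apply.
  by rewrite lerD2l ler_pM2r ?invr_gt0// ler_nat leq_subr.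
apply/cvgr0Pnorm_lt => e e0.
have e20 : 0 < e / 2 by lra.
have [r _ /(_ r (leqnn r)) /= re] : \forall r \near \oo, r.+1%:R^-1 < e / 2.
  exact: near_infty_natSinv_lt (PosNum e20).
have [N _ NP] : \forall N \near \oo, K * (r + m r)%:R / (e / 2) < N%:R.
  exact: nbhs_infty_gtr.
exists N => // n /= /NP; rewrite ltr_pdivrMr// => nP.
rewrite normrZ ger0_norm ?invr_ge0// mulrC ltr_pdivrMr//.
have := all_ r n.+1; rewrite big_mkord => /le_lt_trans; apply.
have : n.+1%:R * r.+1%:R^-1 <= n.+1%:R * (e / 2) by rewrite ler_pM2l// ltW.
move: nP; rewrite -(nat1r n); move: (K * _) (_ / r.+1%:R) => S T; lra.
Qed.

Variables (U : set_system nat).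
Hypothesis UU : UltraFilter U.
Hypothesis ooU : \oo `<=` U.

(** The terms are picked one by one. The invariant good says that for every
    block under way, the iterated limit over its missing terms is below the
    bound; U-almost all next terms preserve it, and on a complete block it is
    the bound itself. *)
Lemma block_subsequence (y : nat -> V) (K : R) (m : nat -> nat) (b : nat -> R) :
  (forall n, `|y n| <= K) -> (forall r, ilim U y (nseq (m r) 1) 0 < b r) ->
  exists2 phi : nat -> nat, {homo phi : i j / (i < j)%N} &
    forall r k, (r <= k)%N -> `|\sum_(k <= i < k + m r) y (phi i)| < b r.
Proof.
move=> yK yb.
pose good (h : seq nat) := forall r k, (r <= k <= size h)%N ->
  (size h - k <= m r)%N ->
  ilim U y (nseq (m r - (size h - k)) 1) (\sum_(i <- drop k h) y i) < b r.
have step h : exists p, good h ->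
    (forall i, i \in h -> (i < p)%N) /\ good (rcons h p).
  have [hg|nh] := pselect (good h); last by exists 0%N.
  pose n := size h.
  have [p [hp pP]] : exists p, (forall i, i \in h -> (i < p)%N) /\
      forall rk : 'I_n.+1 * 'I_n.+1, (rk.1 <= rk.2)%N -> (n - rk.2 < m rk.1)%N ->
      ilim U y (nseq (m rk.1 - (n - rk.2)).-1 1)
        (\sum_(i <- drop rk.2 h) y i + 1 *: y p) < b rk.1.
    apply: (@filter_ex _ U); apply: filterI.
      apply: ooU; exists (\max_(i <- h) i).+1 => // p /= hp i ih.
      by apply: leq_ltn_trans hp; exact: leq_bigmax_seq.
    apply: filter_forall => -[r k] /=.
    have [rk|] := boolP ((r <= k) && (n - k < m r))%N; last first.
      by move=> nrk; apply: filterE => p r1 k1; rewrite r1 k1 in nrk.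
    have /andP[rk1 kn] := rk.
    have := hg r k; rewrite rk1 -ltnS ltn_ord => /(_ isT (ltnW kn)).
    rewrite -/n -{1}(prednK (_ : 0 < m r - (n - k)))%N ?subn_gt0// => lt.
    have Ulim := @cvgr_lt R _ U _ _ _ (@ilim_cvg _ _ _ UU _ _ yK 1 _ _) _ lt.
    by apply: (@filterS _ U _ _ _ _ (Ulim _)) => p ? _ _.
  exists p => _; split=> // r k; rewrite size_rcons -/n => /andP[rk].
  rewrite leq_eqVlt => /predU1P[->|]; last move=> kn.
    rewrite subnn subn0 => _.
    by rewrite drop_oversize ?size_rcons// big_nil; exact: yb.
  rewrite subSn// => nk.
  have := pP (Ordinal (leq_ltn_trans rk kn : r < n.+1)%N, Ordinal kn) rk nk.
  by rewrite scale1r drop_rcons// -cats1 big_cat big_seq1 subnS.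
have [next nextP] := choice step.
pose hist := fix hist n :=
  if n is n'.+1 then rcons (hist n') (next (hist n')) else [::].
pose phi n := next (hist n).
have histE n : hist n = mkseq phi n.
  by elim: n => // n IH; rewrite mkseqS -IH.
have histg n : good (hist n).
  elim: n => [|n IH]; last exact: (nextP _ IH).2.
  move=> r k; rewrite leqn0 => /andP[_ /eqP ->] _.
  by rewrite big_nil /= !subn0; exact: yb.
have phiS i j : (i < j)%N -> (phi i < phi j)%N.
  move=> ij; apply: (nextP _ (histg j)).1.
  by rewrite histE map_f// mem_iota.
exists phi; first exact: phiS.
move=> r k rk; have := histg (k + m r)%N r k.
rewrite histE size_mkseq rk leq_addr addKn leqnn subnn => /(_ isT isT) /=.
by rewrite /mkseq -map_drop big_map drop_iota /index_iota.
Qed.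

End Cesaro.

(** * Ultrapowers *)

(** Integer vectors approximate large multiples of a real vector with bounded
    error; after division by the multiple, both this error and the defect 1 in
    the assumption become negligible. *)
Lemma l1_of_int (R : realType) (V : normedModType R) (e : nat -> V) (K c : R) :
  0 < c -> (forall j, `|e j| <= K) ->
  (forall s : seq int, c * \sum_(i <- s) `|i|%:~R - 1 <=
     `|\sum_(j < size s) (s`_j)%:~R *: e j|) ->
  forall n (a : nat -> R), c * \sum_(k < n) `|a k| <= `|\sum_(k < n) a k *: e k|.
Proof.
move=> c0 eK ec n a; have K0 : 0 <= K by exact: le_trans (eK 0%N).
set S := \sum_(k < n) `|a k|; set D := `|_|.
rewrite leNgt; apply/negP => DS.
pose T := c * n%:R + 1 + K * n%:R.
suff NT (N : nat) : N%:R * (c * S - D) <= T.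
  have [N _ /(_ N (leqnn N)) /=] : \forall N \near \oo, T / (c * S - D) < N%:R.
    exact: nbhs_infty_gtr.
  by rewrite ltr_pdivrMr ?subr_gt0// ltNge NT.
pose t k : int := Num.floor (N%:R * a k).
have tP k : `|N%:R * a k - (t k)%:~R| <= 1.
  have := Num.Theory.floor_itv (N%:R * a k); rewrite -/(t k) => /andP[t1].
  by rewrite intrD => t2; rewrite ler_norml; apply/andP; split; lra.
have tsum : \sum_(i <- mkseq t n) (`|i|%:~R : R) = \sum_(k < n) `|t k|%:~R.
  by rewrite big_map -(big_mkord xpredT (fun k => `|t k|%:~R)) /index_iota subn0.
have := ec (mkseq t n); rewrite tsum size_mkseq.
under [X in _ <= `|X|]eq_bigr do rewrite nth_mkseq//.
move=> tS.
have S1 : N%:R * S <= \sum_(k < n) `|t k|%:~R + n%:R.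
  rewrite mulr_sumr -[in n%:R](card_ord n) -sum1_card natr_sum -big_split/=.
  apply: ler_sum => k _; have := tP k.
  have := ler_normD (N%:R * a k - (t k)%:~R) (t k)%:~R.
  by rewrite subrK normrM normr_nat intr_norm; lra.
have S2 : `|\sum_(k < n) (t k)%:~R *: e k| <= N%:R * D + K * n%:R.
  have -> : \sum_(k < n) (t k)%:~R *: e k = N%:R *: (\sum_(k < n) a k *: e k)
      + \sum_(k < n) ((t k)%:~R - N%:R * a k) *: e k.
    rewrite scaler_sumr -big_split/=; apply: eq_bigr => k _.
    by rewrite scalerA -scalerDl; congr (_ *: _); ring.
  rewrite (le_trans (ler_normD _ _))// normrZ normr_nat lerD2l.
  rewrite (le_trans (ler_norm_sum _ _ _))//.
  rewrite -[in n%:R](card_ord n) -sum1_card natr_sum mulr_sumr.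
  apply: ler_sum => k _; rewrite normrZ mulr1 distrC.
  by rewrite -[leRHS]mul1r ler_pM.
have := ler_wpM2l (ltW c0) S1; rewrite /T; move: tS S2.
rewrite mulrBr; lra.
Qed.

Section UltrapowerL1.
Variables (R : realType) (V : normedModType R).

Lemma ultra_norm_ge (U : free_ultrafilter) (x : linfty V) (b : R) :
  fu_set U [set n | b <= `|x n|] -> b <= `|ultra_class U x|.
Proof.
move=> bx; apply/ler_addgt0Pr => e e0; have e20 : 0 < e / 2 by lra.
have [z [/esym/ultra_class_eq/null_seqsP/(_ _ e20) xz]] :=
  ultra_norm_adherent (ultra_class U x) e20.
have [n [/= bn xzn]] := filter_ex (filterI bx xz).
have := linfty_norm_ub z n; have := ler_normD (x n - z n) (z n).
rewrite subrK -[`|ultra_class U x|]/(ultra_norm (ultra_class U x)).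
by rewrite -[`|z|]/(linfty_norm z); lra.
Qed.

(** The n-th coordinates are terms of y that work simultaneously for the first n
    integer vectors in an enumeration; every integer vector is thus taken care
    of by all but finitely many coordinates. *)
Lemma ultra_l1 (U : free_ultrafilter) (y : nat -> V) (K c : R) :
  \oo `<=` fu_set U -> 0 < c -> (forall n, `|y n| <= K) ->
  (forall s : seq int, c * \sum_(i <- s) `|i|%:~R <= ilim (fu_set U) y (map intr s) 0) ->
  exists2 e : nat -> ultrapower V U, (forall j, ultra_set U (range y) (e j)) &
  forall n (a : nat -> R), c * \sum_(k < n) `|a k| <= `|\sum_(k < n) a k *: e k|.
Proof.
move=> ooU c0 yK yc.
have sel n : exists t : nat -> nat, forall s : seq int, (pickle s < n)%N ->
    c * \sum_(i <- s) `|i|%:~R - 1 <= `|\sum_(j < size s) (s`_j)%:~R *: y (t j)|.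
  (* The defect 1 makes the bound strict, even for the zero vector. *)
  pose s (i : 'I_n) : seq int := odflt [::] (unpickle i).
  have [||t tP] := @ilim_select _ _ _ (fu_ultra U) _ _ yK 'I_n
     (\max_(i < n) size (s i)) (fun i => map intr (s i)) (fun=> 0)
     (fun i => c * \sum_(j <- s i) `|j|%:~R - 1).
  - by move=> i; rewrite size_map (leq_bigmax i).
  - by move=> i; have := yc (s i); lra.
  exists t => u un; have := tP (Ordinal un).
  have -> : s (Ordinal un) = u by rewrite /s pickleK.
  rewrite add0r.
  rewrite size_map => /ltW /le_trans; apply.
  by under eq_bigr do rewrite (nth_map 0)//.
have [t tP] := choice sel.
have eb j : (fun n => y (t n j)) \in @bounded_seqs R V.
  by apply/bounded_seqsP; exists K.
pose E j := Linfty (eb j).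
exists (fun j => ultra_class U (E j)) => [j|].
  by exists (E j) => // n; exists (t n j).
have EK j : `|ultra_class U (E j)| <= K.
  have le1 : `|ultra_class U (E j)| <= `|E j| by exact: ultra_norm_le.
  by apply: (le_trans le1); apply: linfty_norm_le => n; exact: yK.
apply: (l1_of_int c0 EK) => s.
have -> : \sum_(j < size s) (s`_j)%:~R *: ultra_class U (E j) =
    ultra_class U (\sum_(j < size s) (s`_j)%:~R *: E j).
  elim/big_rec2 : _ => [|j u v _ ->]; first by rewrite ultra_class0.
  by rewrite -ultra_classZ ultra_classD.
apply: ultra_norm_ge; apply: ooU; exists (pickle s).+1 => // n /= sn.
have -> : (\sum_(j < size s) (s`_j)%:~R *: E j) n =
    \sum_(j < size s) (s`_j)%:~R *: y (t n j).
  by elim/big_rec2 : _ => // j u v _ <-.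
exact: tP.
Qed.

End UltrapowerL1.

Theorem proposition2p5 (R : realType) (X : completeNormedModType R) :
  ((forall A : set X,
      relatively_weakly_compact A -> relatively_super_weakly_compact A) ->
   weak_banach_saks_property X) /\
  (property_R X ->
   forall A : set X,
     relatively_weakly_compact A -> relatively_super_weakly_compact A).
Proof.
split=> [super|XR A Ac]; last first.
  by apply: XR; exact: relatively_weakly_compact_weakly_precompact.
split; first by exists 1; split => // M /ltW M1 x /= x1; exact: le_trans x1 M1.
move=> x x1 [l xl].
have [U [UU ooU]] := @ultraFilterLemma _ \oo _.
have Ufree : \bigcap_(A in U) A = set0.
  apply/seteqP; split=> // N NU.
  have : [set n | (N < n)%N] N by apply: NU; apply: ooU; exists N.+1.
  by rewrite /= ltnn.
pose F := FreeUltrafilter UU Ufree.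
pose y n := x n - l; pose K := 1 + `|l|.
have yK n : `|y n| <= K by rewrite (le_trans (ler_normB _ _))// lerD2r; exact: x1.
have y0 C f : functional C f -> f \o y @ \oo --> 0.
  move=> fC; have [G Gf] := functional_dual fC.
  apply/cvgr0Pnorm_lt => e e0; have [N _ NP] := xl _ (weak_nbhs G l e0).
  exists N => // n Nn; have := NP n Nn.
  by rewrite /= !Gf /y (functionalB _ _ fC).
have y0U C f : functional C f -> f \o y @ U --> 0.
  by move=> /y0 fy B /fy; exact: ooU.
have [[c [c0 yc]]|nc] := pselect (exists c, 0 < c /\
    forall k, c * k%:R <= ilim U y (nseq k 1) 0).
  have c20 : 0 < c / 2 by lra.
  have yl1 s := ilim_l1 UU yK y0U s (ltW c0) yc.
  have [e eA el1] := @ultra_l1 R X F y K (c / 2) ooU c20 yK yl1.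
  have := super _ (relatively_weakly_compact_null y0) F.
  by move/(l1_not_relatively_weakly_compact c20 eA el1).
have /choice[m mP] : forall r : nat, exists m : nat,
    ilim U y (nseq m 1) 0 < m%:R / r.+1%:R.
  move=> r; apply: contrapT => /forallNP h; apply: nc.
  exists r.+1%:R^-1; split=> [|k]; first by rewrite invr_gt0.
  by rewrite leNgt mulrC; apply/negP.
have m0 r : (0 < m r)%N.
  by rewrite lt0n; apply/eqP => m0; have := mP r; rewrite m0 /= normr0 mul0r ltxx.
have [phi phiS phib] := block_subsequence UU ooU yK mP.
exists phi => //.
have yphi := cesaro_blocks (fun n => yK (phi n)) m0 (fun r k rk => ltW (phib r k rk)).
apply/cvg_ex; exists (0 + l).
apply: cvg_trans (cvgD yphi (cvg_cst l)).
apply: near_eq_cvg; apply: nearW => n /=.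
have -> : \sum_(k < n.+1) x (phi k) = \sum_(k < n.+1) y (phi k) + n.+1%:R *: l.
  rewrite scaler_nat -[n.+1 in X in _ + X]card_ord -sumr_const -big_split/=.
  by apply: eq_bigr => k _; rewrite subrK.
by rewrite scalerDr scalerK ?pnatr_eq0.
Qed.
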